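(* Let $n\ge 1$ be an integer, let $E$ be a Banach space and let $\tau$ be a Hausdorff topology on $E$. Let $\{T(p): p\in\mathbb{R}_+^n\}$ be an $n$-parameter $\tau$-continuous semigroup of nonexpansive mappings on a compact convex subset $C$ of $E$ (compact in the norm topology). Let $p_1,\dots,p_n\in\mathbb{R}_+^n$ be linearly independent (over $\mathbb{R}$, in the usual sense). Let $\alpha_1,\dots,\alpha_n\in\mathbb{R}$ be such that $\{1,\alpha_1,\dots,\alpha_n\}$ is linearly independent over $\mathbb{Q}$ and $p_0=\alpha_1p_1+\cdots+\alpha_np_n\in\mathbb{R}_+^n$. Define mappings $S_j$ on $C$ by $$S_jx=\tfrac12T(p_j)x+\tfrac12x\qquad(x\in C,\ j=0,1,\dots,n).$$ Let $x_1\in C$ and define a sequence $\{x_k\}$ in $C$ by $$x_{k+1}=\left[\prod_{k_n=1}^{k}\left[S_n\prod_{k_{n-1}=1}^{k_n}\left[S_{n-1}\cdots\left[S_2\prod_{k_1=1}^{k_2}\left[S_1\prod_{k_0=1}^{k_1}S_0\right]\right]\cdots\right]\right]\right]x_1\qquad(k\in\mathbb{N}).$$ Then $\{x_k\}$ converges strongly to a common fixed point of $\{T(p): p\in\mathbb{R}_+^n\}$.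
   Context: $\mathbb{N}$ is the set of positive integers and $\mathbb{R}_+^n=[0,\infty)^n$. A family $\{T(p): p\in\mathbb{R}_+^n\}$ of mappings from $C$ into $C$ is an $n$-parameter $\tau$-continuous semigroup of nonexpansive mappings on $C$ if (sg 1) $T(p+q)=T(p)\circ T(q)$ for all $p,q\in\mathbb{R}_+^n$; (sg 2) for each $x\in C$, the map $p\mapsto T(p)x$ from $\mathbb{R}_+^n$ into $C$ is continuous with respect to $\tau$; and (sg 3) each $T(p)$ is nonexpansive, i.e. $\|T(p)x-T(p)y\|\le\|x-y\|$ for all $x,y\in C$. A common fixed point is a $z\in C$ with $T(p)z=z$ for all $p\in\mathbb{R}_+^n$. Real numbers $\{\gamma_1,\dots,\gamma_m\}$ are linearly independent over $\mathbb{Q}$ if there is no nonzero $(\nu_1,\dots,\nu_m)\in\mathbb{Z}^m$ with $\sum_i\nu_i\gamma_i=0$. Products of mappings are compositions, with $\prod_{i=1}^mA_i=A_m\circ A_{m-1}\circ\cdots\circ A_1$ (the factor with index $1$ is applied first). Equivalently, setting $P_0(m)=S_0^m$ and, for $1\le j\le n$, $P_j(m)=\big(S_jP_{j-1}(m)\big)\circ\big(S_jP_{j-1}(m-1)\big)\circ\cdots\circ\big(S_jP_{j-1}(1)\big)$ for $m\in\mathbb{N}$, one has $x_{k+1}=P_n(k)x_1$. *)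

(* Defs.v *)
From mathcomp Require Import all_boot all_order all_algebra.
From mathcomp Require Import all_classical all_reals all_analysis.
Import Order.TTheory GRing.Theory Num.Theory.
Import numFieldNormedType.Exports.

Set Implicit Arguments.
Unset Strict Implicit.
Unset Printing Implicit Defensive.

Local Open Scope classical_set_scope.
Local Open Scope ring_scope.

(* A topology [tau] on the carrier of a Banach space [E] is an element of the
   class [Topological E]; [with_topology tau] is the carrier of [E] endowed
   with [tau], which need not be related to the norm topology. *)
Definition with_topology (T : Type) (tau : Topological T) : topologicalType :=
  Topological.Pack tau.

Definition nonneg_orthant (R : realType) (n : nat) : set 'rV[R]_n :=
  [set p | forall i, 0 <= p ord0 i].

(* [T p] is a total function on [E]; only its restriction to [C], for [p] in
   the nonnegative orthant, is meaningful and constrained. *)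
Record nonexpansive_semigroup (R : realType) (n : nat)
    (E : completeNormedModType R) (tau : Topological E) (C : set E)
    (T : 'rV[R]_n -> E -> E) : Prop := NonexpansiveSemigroup {
  semigroup_stable : forall p x, nonneg_orthant p -> C x -> C (T p x) ;
  semigroup_add : forall p q x, nonneg_orthant p -> nonneg_orthant q -> C x ->
    T (p + q) x = T p (T q x) ;
  semigroup_continuous : forall x, C x ->
    {within @nonneg_orthant R n,
       continuous ((fun p => T p x) : 'rV[R]_n -> with_topology tau)} ;
  semigroup_nonexpansive : forall p x y, nonneg_orthant p -> C x -> C y ->
    `|T p x - T p y| <= `|x - y|
}.

Definition common_fixed_point (R : realType) (n : nat) (E : Type) (C : set E)
    (T : 'rV[R]_n -> E -> E) (z : E) : Prop :=
  C z /\ forall p, nonneg_orthant p -> T p z = z.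

Definition rat_independent (R : realType) (m : nat) (g : m.-tuple R) : Prop :=
  ~ exists nu : 'rV[int]_m,
      nu != 0 /\ \sum_(i < m) (nu ord0 i)%:~R * tnth g i = 0.

(* A m \o ... \o A 2 \o A 1; the map A 0 is not used *)
Fixpoint iter_comp (E : Type) (A : nat -> E -> E) (m : nat) : E -> E :=
  if m is m'.+1 then A m'.+1 \o iter_comp A m' else id.

(* P_0(m) = S_0^m and
   P_j(m) = (S_j P_(j-1)(m)) o ... o (S_j P_(j-1)(2)) o (S_j P_(j-1)(1)) *)
Fixpoint nested_comp (E : Type) (S : nat -> E -> E) (j m : nat) : E -> E :=
  if j is j'.+1 then iter_comp (fun k => S j'.+1 \o nested_comp S j' k) m
  else iter_comp (fun=> S 0%N) m.

(* Main.v *)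
(* Common fixed points of T(p_0), ..., T(p_n) are fixed by T(q) for every q that
   is an integer combination of the p_j; by Kronecker's theorem these q are
   dense, and continuity for a Hausdorff topology suffices to conclude.

   That x_k tends to a common fixed point of the T(p_j) is Ishikawa's theorem on
   commuting nonexpansive maps, proved by induction on j. Suppose that
   P_{j-1}(m) tends pointwise to Q, a nonexpansive retraction onto the set F of
   common fixed points of T(p_0), ..., T(p_{j-1}). The cluster set K of
   y_m = S_j P_{j-1}(m) y_{m-1} is then mapped into itself by S_j Q. Along the
   orbit under Q S_j of a point u of F, the distance |T(p_j) u - u| does not
   increase, and it is constant if u = Q s where s in K minimises it; the
   Goebel-Kirk inequality, which survives the retraction Q, then makes it zero by
   boundedness. So K contains a common fixed point, and since the distance of y_m
   to that point does not increase, y_m converges to it. *)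
Require Import Defs.
From mathcomp Require Import all_boot all_order all_algebra.
From mathcomp Require Import ring lra zify.
From mathcomp Require Import all_classical all_reals all_analysis.
Import Order.TTheory GRing.Theory Num.Theory.
Import numFieldNormedType.Exports.
Local Open Scope classical_set_scope.
Local Open Scope ring_scope.

(** * Averaged nonexpansive maps on a compact set *)

Lemma convex_set_midpoint {R : realType} {E : normedModType R} {C : set E} :
  convex_set C -> forall x y, C x -> C y -> C (2^-1 *: x + 2^-1 *: y).
Proof.
move=> hC x y Cx Cy.
have h0 : 0 <= 2^-1 :> R by lra.
have h1 : 2^-1 <= 1 :> R by lra.
have := hC x y (Itv01 h0 h1); rewrite !inE => /(_ Cx Cy).
have half : unstable.onem 2^-1 = 2^-1 :> R by rewrite /unstable.onem; lra.
by rewrite /conv /= half.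
Qed.

Lemma clusterP {R : realType} {E : normedModType R} (y : nat -> E) (z : E) :
  cluster (y @ \oo) z <->
  forall e N, 0 < e -> exists2 m, (N <= m)%N & `|z - y m| < e.
Proof.
split=> [hz e N e0|hz A B [N _ hN] /nbhs_ballP[e /= e0 he]].
  have hA : (y @ \oo) (y @` [set m | (N <= m)%N]).
    by exists N => // m /= Nm; exists m.
  have [_ [[m /= Nm <-]]] := hz _ _ hA (nbhsx_ballx z e e0).
  by rewrite -ball_normE /= => h; exists m.
have [m Nm hm] := hz e N e0.
by exists (y m); split; [exact: hN|apply: he; rewrite -ball_normE].
Qed.

Lemma closed_cluster {T : topologicalType} (F : set_system T) :
  closed (cluster F).
Proof. by rewrite clusterE; apply: closed_bigI => A _; exact: closed_closure. Qed.

Lemma lipschitz_within_continuous {R : realType} {E : normedModType R}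
    (A : set E) (f : E -> R) (L : R) :
  (forall x y, A x -> A y -> `|f x - f y| <= L * `|x - y|) ->
  {within A, continuous f}.
Proof.
move=> hf; apply/subspace_continuousP => x Ax.
apply/cvgrPdist_lt => e e0.
have L0 : 0 < `|L| + 1 by rewrite ltr_wpDl.
have de : 0 < e / (`|L| + 1) by rewrite divr_gt0.
rewrite near_withinE; near=> y => Ay.
apply: le_lt_trans (hf _ _ Ax Ay) _.
have xy : `|x - y| < e / (`|L| + 1).
  by near: y; apply: cvgr_dist_lt => //; exact: cvg_id.
apply: le_lt_trans (_ : (`|L| + 1) * `|x - y| < e); last first.
  by rewrite mulrC -ltr_pdivlMr.
by rewrite ler_wpM2r//; have := ler_norm L; lra.
Unshelve. all: by end_near. Qed.

(* The case of constant [`|v k - u k|] of the Goebel-Kirk inequality: bounded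
   sequences can satisfy it only if [d = 0]. *)
Lemma goebel_kirk {R : realType} {E : normedModType R} (u v : nat -> E) (d : R) :
  (forall k, d <= `|v k - u k|) ->
  (forall k, `|v k.+1 - v k| <= d / 2) ->
  (forall i j, `|v j - u i.+1| <= 2^-1 * `|v j - u i| + 2^-1 * `|v j - v i|) ->
  forall k i, (1 + k%:R / 2) * d <= `|v (i + k)%N - u i|.
Proof.
move=> hd hv hc.
have vk i k : `|v (i + k)%N - v i| <= k%:R * (d / 2).
  elim: k => [|k IH]; first by rewrite addn0 subrr normr0 mul0r.
  rewrite addnS -natr1 mulrDl mul1r.
  apply: le_trans (ler_distD (v (i + k)%N) _ _) _.
  by rewrite addrC lerD.
elim=> [|k IH] i; first by rewrite mul0r addr0 mul1r addn0.
(* In [h3] the left side is at least [(1 + k / 2) * d] and the last distance at most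
   [(k + 1) * d / 2]; solving for the middle one gives the claim. *)
have h1 := IH i.+1; have h2 := vk i k.+1; have h3 := hc i (i + k.+1)%N.
rewrite addSnnS in h1; rewrite -natr1 in h2 *; lra.
Qed.

Definition nonexpansive_selfmap {R : realType} {E : normedModType R}
    (C : set E) (f : E -> E) : Prop :=
  (forall x, C x -> C (f x)) /\
  (forall x y, C x -> C y -> `|f x - f y| <= `|x - y|).

Lemma nonexpansive_limit {R : realType} {E : normedModType R} {C : set E}
    {A : nat -> E -> E} {Q : E -> E} :
  (forall m, nonexpansive_selfmap C (A m)) ->
  (forall x, C x -> (fun m => A m x) @ \oo --> Q x) ->
  forall x y, C x -> C y -> `|Q x - Q y| <= `|x - y|.
Proof.
move=> hA hQ x y Cx Cy.
have h : (fun m => `|A m x - A m y|) @ \oo --> `|Q x - Q y|.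
  by apply: cvg_norm; apply: cvgB; exact: hQ.
apply: (ler_cvg_to h (cvg_cst _)).
by apply: nearW => m; exact: (hA m).2.
Qed.

(** One level of the induction: [A m] stands for P_{j-1}(m) and [F] for the common fixed points of
    the earlier maps. The case [A m = id], [F = C] starts the induction. *)
Lemma averaged_iteration_cvg {R : realType} {E : normedModType R}
    (C F : set E) (T S : E -> E) (A : nat -> E -> E) (y : nat -> E) :
  compact C -> F `<=` C ->
  nonexpansive_selfmap C T -> nonexpansive_selfmap C S ->
  (forall m, nonexpansive_selfmap C (A m)) ->
  (forall x, C x -> S x = 2^-1 *: T x + 2^-1 *: x) ->
  (forall x, F x -> F (T x)) ->
  (forall m x, F x -> A m x = x) ->
  (forall x, C x -> exists2 q, F q & (fun m => A m x) @ \oo --> q) ->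
  C (y 0%N) -> (forall m, y m.+1 = S (A m.+1 (y m))) ->
  exists2 w, F w /\ T w = w & y @ \oo --> w.
Proof.
move=> cptC FC [TC Tne] [SC Sne] hA SE FT AF hQ Cy0 yS.
pose Q x := lim ((fun m => A m x) @ \oo).
have cvgQ x : C x -> (fun m => A m x) @ \oo --> Q x.
  by move=> /hQ[q _ Aq]; rewrite /Q (cvg_lim _ Aq)//; exact: norm_hausdorff.
have FQ x : C x -> F (Q x).
  by move=> /hQ[q Fq Aq]; rewrite /Q (cvg_lim _ Aq)//; exact: norm_hausdorff.
have QC x : C x -> C (Q x) by move=> /FQ /FC.
have Qid x : F x -> Q x = x.
  move=> Fx; apply: cvg_lim; first exact: norm_hausdorff.
  by under eq_fun do rewrite AF//; exact: cvg_cst.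
have Qne := nonexpansive_limit hA cvgQ.
have Cy m : C (y m).
  by elim: m => // m IH; rewrite yS; apply: SC; apply: (hA _).1.
pose K := cluster (y @ \oo).
have KC : K `<=` C.
  move=> z Kz; apply: (compact_closed _ cptC); first exact: norm_hausdorff.
  by move: Kz; rewrite /K clusterE => /(_ C); apply; exists 0%N => // m _; exact: Cy.
have K0 : K !=set0.
  have [|z [_ Kz]] := cptC (y @ \oo) _; last by exists z.
  by exists 0%N => // m _; exact: Cy.
have cptK : compact K by apply: subclosed_compact KC => //; exact: closed_cluster.
(* If [y m] is near [z] with [m] large, then [A m.+1 (y m)] is near [A m.+1 z], hence near [Q z]. *)
have KH z : K z -> K (S (Q z)).
  move=> Kz; have Cz := KC _ Kz; apply/clusterP => e N e0.
  have e20 : 0 < e / 4 by rewrite divr_gt0.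
  have [M _ hM] := (cvgrPdist_lt _ _).1 (cvgQ z Cz) _ e20.
  have [m Nm hm] := (clusterP _ _).1 Kz (e / 4) (maxn N M) e20.
  exists m.+1; first by lia.
  rewrite yS; apply: le_lt_trans (Sne _ _ (QC _ Cz) ((hA _).1 _ (Cy _))) _.
  apply: le_lt_trans (ler_distD (A m.+1 z) _ _) _.
  have h1 : `|Q z - A m.+1 z| < e / 4 by apply: hM => /=; lia.
  have h2 := (hA m.+1).2 _ _ Cz (Cy m).
  lra.
pose phi z := `|T (Q z) - Q z|.
have phi_cont : {within K, continuous phi}.
  apply: (lipschitz_within_continuous K phi 2) => a b /KC Ca /KC Cb.
  apply: le_trans (ler_dist_dist _ _) _.
  have h1 := Qne _ _ Ca Cb; have h2 := Tne _ _ (QC _ Ca) (QC _ Cb).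
  have -> : T (Q a) - Q a - (T (Q b) - Q b) = T (Q a) - T (Q b) - (Q a - Q b).
    by rewrite !opprB addrACA [- Q a + _]addrC addrACA addrA.
  by apply: le_trans (ler_normB _ _) _; lra.
have [s Ks smin] := compact_EVT_min K0 cptK phi_cont.
move/set_mem: Ks => Ks.
(* [phi] does not increase under [S \o Q], which maps [K] into itself: it is
   constant along the orbit of its minimiser [s]. *)
pose h k := iter k (fun z => S (Q z)) s.
have Kh k : K (h k) by elim: k => // k; exact: KH.
have Ch k : C (h k) by exact: KC.
pose u k := Q (h k); pose v k := T (u k); pose d := phi s.
have Cu k : C (u k) by exact: QC.
have Fu k : F (u k) by exact: FQ.
have Cv k : C (v k) by exact: TC.
have Fv k : F (v k) by exact: FT.
have uS k : u k.+1 = Q (S (u k)) by [].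
have dge k : d <= `|v k - u k| by apply: smin; exact/mem_set.
have half0 : 0 <= 2^-1 :> R by rewrite invr_ge0.
have Su k z : z - S (u k) = 2^-1 *: (z - u k) + 2^-1 *: (z - v k).
  rewrite SE// -/(v k) !scalerBr opprD [RHS]addrACA -scalerDl.
  have -> : 2^-1 + 2^-1 = 1 :> R by lra.
  by rewrite scale1r [- _ + - _]addrC.
(* [Q] fixes [z] and is nonexpansive, so the estimate for the average [S (u i)] passes to
   [u i.+1]. *)
have toward i z : F z ->
    `|z - u i.+1| <= 2^-1 * `|z - u i| + 2^-1 * `|z - v i|.
  move=> Fz; rewrite uS -{1}(Qid z Fz).
  apply: le_trans (Qne _ _ (FC _ Fz) (SC _ (Cu i))) _.
  rewrite Su; apply: le_trans (ler_normD _ _) _.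
  by rewrite !normrZ ger0_norm.
have step k : `|v k - u k| = d -> `|u k.+1 - u k| <= d / 2.
  move=> dk; rewrite distrC; apply: le_trans (toward k _ (Fu k)) _.
  by rewrite subrr normr0 mulr0 add0r distrC dk mulrC.
have vstep k : `|v k - u k| = d -> `|v k.+1 - v k| <= d / 2.
  by move=> dk; apply: le_trans (Tne _ _ (Cu _) (Cu _)) (step k dk).
(* Minimality gives one inequality; for the other, both legs through [v k] have length at most
   [d / 2]. *)
have dE k : `|v k - u k| = d.
  elim: k => [//|k IH]; apply/eqP; rewrite eq_le dge andbT.
  apply: le_trans (ler_distD (v k) _ _) _.
  have := vstep k IH; have := toward k _ (Fv k).
  by rewrite subrr normr0 mulr0 addr0 IH; lra.
have GK := goebel_kirk u v d dge (fun k => vstep k (dE k))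
  (fun i j => toward i _ (Fv j)).
have d0 : d = 0.
  apply/eqP; rewrite eq_le normr_ge0 andbT leNgt; apply/negP => dpos.
  have [B [_ hB]] := compact_bounded cptC.
  have {}hB z : C z -> `|z| <= `|B| + 1.
    by apply: hB; have := ler_norm B; lra.
  (* [b] bounds distances in [C], and [k] is chosen so that [k * d / 2] exceeds [b]. *)
  pose b := 2 * (`|B| + 1).
  pose k := (Num.trunc (2 * b / d)).+1.
  have bk : 2 * b / d < k%:R by exact: truncnS_gt.
  rewrite ltr_pdivrMr// in bk.
  have := GK k 0%N; rewrite add0n.
  have := ler_normB (v k) (u 0%N).
  have := hB _ (Cv k); have := hB _ (Cu 0%N).
  rewrite /b in bk; lra.
pose w := Q s.
have Fw : F w by exact/FQ/KC.
have Tw : T w = w by apply/eqP; rewrite -subr_eq0 -normr_eq0; apply/eqP.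
have Cw : C w := FC _ Fw.
have Sw : S w = w.
  rewrite SE// Tw -scalerDl (_ : 2^-1 + 2^-1 = 1 :> R) ?scale1r//; lra.
(* As [w = Q s], invariance of [K] under [S \o Q] puts [S w = w] back in [K]. *)
have Kw : K w by rewrite -Sw; exact: KH.
exists w => //; apply/cvgrPdist_lt => e e0.
have [m _ hm] := (clusterP _ _).1 Kw e 0%N e0.
exists m => // m' /=; elim: m' => [|m' IH] mm'.
  by move: mm' hm; rewrite leqn0 => /eqP ->.
move: mm'; rewrite leq_eqVlt => /predU1P[<-//|/IH lt_e].
rewrite yS -{1}Sw; apply: le_lt_trans lt_e.
apply: le_trans (Sne _ _ Cw ((hA _).1 _ (Cy _))) _.
by rewrite -{1}(AF m'.+1 w Fw); apply: (hA _).2.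
Qed.

(** * Kronecker's theorem *)

(** Independence of 1 and the [a i] over the rationals, denominators cleared; the coefficient of 1
    is kept apart because Kronecker's theorem works modulo integers. *)
Definition int_independent {R : realType} {n : nat} (a : 'I_n -> R) : Prop :=
  forall (k0 : int) (k : 'I_n -> int),
    k0%:~R + \sum_i (k i)%:~R * a i = 0 -> k0 = 0 /\ forall i, k i = 0.

Lemma truncn_eq_dist (R : realType) (u v : R) :
  0 <= u -> 0 <= v -> Num.trunc u = Num.trunc v -> `|u - v| < 1.
Proof.
move=> u0 v0 E.
have /andP[u1 u2] := truncn_itv u0; have /andP[v1 v2] := truncn_itv v0.
rewrite E in u1 u2; rewrite -natr1 in u2 v2.
by rewrite ltr_distl; apply/andP; split; lra.
Qed.

(** Pigeonhole: cut the unit cube into [M ^ n] cells of side [1 / M < e]. Among [M ^ n + 1]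
    multiples of [a], two have fractional parts in the same cell, and [q] is the difference of the
    multipliers. *)
Lemma dirichlet_approximation (R : realType) (n : nat) (a : 'I_n -> R) (e : R) :
  0 < e ->
  exists (q : int) (l : 'I_n -> int),
    q != 0 /\ forall i, `|q%:~R * a i - (l i)%:~R| < e.
Proof.
move=> e0.
pose M := (Num.trunc e^-1).+1.
have Me : 1 < M%:R * e.
  by rewrite -ltr_pdivrMr// mul1r truncnS_gt.
have M0 : 0 < M%:R :> R by rewrite ltr0n.
pose frac (x : R) := x - (Num.floor x)%:~R.
have frac_itv x : 0 <= frac x < 1.
  have /andP[h1 h2] := floor_itv x; rewrite intrD in h2.
  by rewrite /frac; apply/andP; split; lra.
pose cell (m : nat) : {ffun 'I_n -> 'I_M} :=
  [ffun i => inord (Num.trunc (M%:R * frac (m%:R * a i)))].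
pose g (m : 'I_(#|{ffun 'I_n -> 'I_M}|.+1)) := cell m.
have : ~~ injectiveb g.
  by apply/negP => /injectiveP /leq_card; rewrite card_ord ltnn.
move=> /injectivePn[m1 [m2 m12 gE]].
exists (m1%:Z - m2%:Z).
exists (fun i => Num.floor (m1%:R * a i) - Num.floor (m2%:R * a i)).
split; first by rewrite subr_eq0 eqz_nat.
move=> i; move/ffunP: gE => /(_ i); rewrite !ffunE => /(congr1 val) /=.
(* So [inord] never takes its default value in [cell]. *)
have lt_trunc (m : nat) : (Num.trunc (M%:R * frac (m%:R * a i))%R < M)%N.
  have /andP[f0 f1] := frac_itv (m%:R * a i).
  by rewrite truncn_lt_nat ?mulr_ge0 ?ler0n// gtr_pMr.
rewrite !inordK// => /truncn_eq_dist.
have /andP[f10 _] := frac_itv (m1%:R * a i).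
have /andP[f20 _] := frac_itv (m2%:R * a i).
rewrite !mulr_ge0 ?ler0n// -mulrBr normrM ger0_norm ?ler0n// => /(_ isT isT) h.
have -> : (m1%:Z - m2%:Z)%:~R * a i -
   (Num.floor (m1%:R * a i) - Num.floor (m2%:R * a i))%:~R =
   frac (m1%:R * a i) - frac (m2%:R * a i) by rewrite /frac !rmorphB /=; ring.
by rewrite -(ltr_pM2l M0); apply: lt_trans Me.
Qed.

(* Estermann's induction: with [d] a small nonzero integer combination of [a],
   solve the problem exactly in coordinate [0] along the line [R d], using the
   induction hypothesis for the slopes [d i / d 0] in the other coordinates,
   then round the real multiple of [d] to an integer one. *)
Lemma kronecker_approximation (R : realType) (n : nat) (a : 'I_n -> R) :
  int_independent a -> forall (t : 'I_n -> R) (e : R), 0 < e ->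
  exists (m : int) (l : 'I_n -> int),
    forall i, `|m%:~R * a i + (l i)%:~R - t i| < e.
Proof.
elim: n a => [|n IHn] a ha t e e0.
  by exists 0, (fun=> 0) => -[].
have e20 : 0 < e / 2 by rewrite divr_gt0.
have [q [p [q0 small]]] := dirichlet_approximation _ _ a _ e20.
pose d i := q%:~R * a i - (p i)%:~R.
have d0 : d ord0 != 0.
  apply/eqP => E; have := ha (- p ord0) (fun i => if i == ord0 then q else 0).
  rewrite (bigD1 ord0)//= big1 ?addr0 => [|i /negPf ->]; last by rewrite mul0r.
  rewrite intrN addrC => /(_ E)[_ /(_ ord0)]; rewrite eqxx => qE.
  by rewrite qE eqxx in q0.
pose b (i : 'I_n) := d (lift ord0 i) / d ord0.
have hb : int_independent b.
  move=> k0 k E.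
  (* Multiplying by [d ord0] turns a relation between 1 and the [b i] into one between the [d i],
     with [k0] as coefficient of [d ord0]. *)
  pose k' i := if unlift ord0 i is Some j then k j else k0.
  have k'0 : k' ord0 = k0 by rewrite /k' unlift_none.
  have k'l j : k' (lift ord0 j) = k j by rewrite /k' liftK.
  have Ed : \sum_i (k' i)%:~R * d i = 0.
    transitivity ((k0%:~R + \sum_i (k i)%:~R * b i) * d ord0); last first.
      by rewrite E mul0r.
    rewrite big_ord_recl k'0 mulrDl mulr_suml; congr (_ + _).
    by apply: eq_bigr => i _; rewrite k'l /b -mulrA divfK.
  have := ha (- \sum_i k' i * p i) (fun i => q * k' i).
  case.
    transitivity (\sum_i (k' i)%:~R * d i) => [|//].
    rewrite intrN [X in - X]rmorph_sum addrC -sumrN -big_split /=.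
    by apply: eq_bigr => i _; rewrite /d !rmorphM /=; ring.
  move=> _ qk; have {}qk i : k' i = 0.
    by have /eqP := qk i; rewrite mulf_eq0 (negPf q0) => /eqP.
  by rewrite -k'0; split => // i; rewrite -k'l.
have [m [l hl]] := IHn b hb
  (fun i => t (lift ord0 i) - t ord0 * b i) (e / 2) e20.
(* The multiplier [m] becomes the integer shift [- m] of coordinate 0, and [s] solves
   [s * d ord0 - m = t ord0]. *)
pose c i := if unlift ord0 i is Some j then l j else - m.
pose s := (t ord0 + m%:~R) / d ord0.
have exact i : `|s * d i + (c i)%:~R - t i| < e / 2.
  case: (unliftP ord0 i) => [j ->|->].
    rewrite /c liftK; move: (hl j); congr (_ < _); congr (`|_|).
    by rewrite /s /b; field.
  rewrite /c unlift_none /s divfK// rmorphN /=.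
  by rewrite (_ : _ - _ = 0) ?normr0//; ring.
pose r := Num.floor s.
have /andP[r1 r2] : r%:~R <= s < r%:~R + 1.
  by have := floor_itv s; rewrite intrD.
exists (r * q), (fun i => c i - r * p i) => i.
have -> : (r * q)%:~R * a i + (c i - r * p i)%:~R - t i =
    (s * d i + (c i)%:~R - t i) - (s - r%:~R) * d i.
  by rewrite rmorphB !rmorphM /= /d; ring.
apply: le_lt_trans (ler_normB _ _) _; rewrite (splitr e).
apply: ltr_leD => //; rewrite normrM.
apply: le_trans (ltW (small i)); rewrite -/(d i).
rewrite ler_piMl// ger0_norm ?subr_ge0//; lra.
Qed.

(** * Convergence of the nested iteration *)

Lemma iter_comp_ind {E : Type} (P : (E -> E) -> Prop) (A : nat -> E -> E) :
  P id -> (forall f g, P f -> P g -> P (f \o g)) -> (forall k, P (A k)) ->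
  forall m, P (iter_comp A m).
Proof. by move=> P1 PM PA; elim=> [//|m IH]; exact: PM. Qed.

Lemma nested_comp_ind {E : Type} (P : (E -> E) -> Prop) (S : nat -> E -> E) j :
  P id -> (forall f g, P f -> P g -> P (f \o g)) ->
  (forall i, (i <= j)%N -> P (S i)) -> forall m, P (nested_comp S j m).
Proof.
move=> P1 PM; elim: j => [|j IH] PS m.
  by apply: iter_comp_ind => // k; exact: PS.
apply: iter_comp_ind => // k; apply: PM; first exact: PS.
by apply: IH => i ij; apply: PS; exact: leqW.
Qed.

Lemma nonexpansive_selfmap_id {R : realType} {E : normedModType R} (C : set E) :
  nonexpansive_selfmap C id.
Proof. by []. Qed.

Lemma nonexpansive_selfmap_comp {R : realType} {E : normedModType R}
    (C : set E) (f g : E -> E) :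
  nonexpansive_selfmap C f -> nonexpansive_selfmap C g ->
  nonexpansive_selfmap C (f \o g).
Proof.
move=> [fC fne] [gC gne]; split=> [x /gC /fC //|x y Cx Cy /=].
by apply: le_trans (fne _ _ (gC _ Cx) (gC _ Cy)) _; exact: gne.
Qed.

Lemma nonexpansive_selfmap_average {R : realType} {E : normedModType R}
    (C : set E) (T S : E -> E) :
  convex_set C -> nonexpansive_selfmap C T ->
  (forall x, C x -> S x = 2^-1 *: T x + 2^-1 *: x) ->
  nonexpansive_selfmap C S.
Proof.
move=> hC [TC Tne] SE; split=> [x Cx|x y Cx Cy].
  by rewrite SE//; apply: convex_set_midpoint => //; exact: TC.
rewrite !SE// opprD addrACA -!scalerBr; apply: le_trans (ler_normD _ _) _.
have half0 : 0 <= 2^-1 :> R by lra.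
by rewrite !normrZ ger0_norm//; have := Tne _ _ Cx Cy; lra.
Qed.

Lemma nested_comp_cvg {R : realType} {E : normedModType R} (C : set E)
    (T S : nat -> E -> E) (n : nat) :
  compact C -> convex_set C ->
  (forall j, (j <= n)%N -> nonexpansive_selfmap C (T j)) ->
  (forall i j x, (i <= n)%N -> (j <= n)%N -> C x -> T i (T j x) = T j (T i x)) ->
  (forall j x, (j <= n)%N -> C x -> S j x = 2^-1 *: T j x + 2^-1 *: x) ->
  forall j x, (j <= n)%N -> C x ->
  exists2 w, C w /\ (forall i, (i <= j)%N -> T i w = w) &
    (fun m => nested_comp S j m x) @ \oo --> w.
Proof.
move=> cptC cvxC hT Tcomm SE.
have hS j : (j <= n)%N -> nonexpansive_selfmap C (S j).
  move=> jn; apply: nonexpansive_selfmap_average (hT _ jn) _ => // x.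
  exact: SE.
have Sfix j w : (j <= n)%N -> C w -> T j w = w -> S j w = w.
  move=> jn Cw Tw; rewrite SE// Tw -scalerDl.
  by rewrite (_ : 2^-1 + 2^-1 = 1 :> R) ?scale1r//; lra.
elim=> [|j IH] x jn Cx.
  have [|w [Cw Tw] cw] := averaged_iteration_cvg C C (T 0%N) (S 0%N) (fun=> id)
    (fun m => nested_comp S 0 m x) cptC (fun _ => id) (hT _ jn) (hS _ jn)
    (fun=> nonexpansive_selfmap_id C) (fun z => SE 0%N z jn) (hT _ jn).1
    (fun _ _ _ => erefl) _ Cx (fun=> erefl).
    by move=> z Cz; exists z => //; exact: cvg_cst.
  by exists w => //; split=> // i; rewrite leqn0 => /eqP ->.
have jn' : (j <= n)%N := ltnW jn.
pose F := [set w | C w /\ forall i, (i <= j)%N -> T i w = w].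
have [| | | |w [[Cw hw] Tw] cw] := averaged_iteration_cvg C F (T j.+1) (S j.+1)
    (nested_comp S j) (fun m => nested_comp S j.+1 m x) cptC _ (hT _ jn)
    (hS _ jn) _ (fun z => SE j.+1 z jn) _ _ (fun z => IH z jn') Cx
    (fun=> erefl).
- by move=> w [].
- apply: nested_comp_ind; first exact: nonexpansive_selfmap_id.
    exact: nonexpansive_selfmap_comp.
  by move=> i ij; apply: hS; exact: leq_trans ij jn'.
(* Commutation makes [T j.+1] preserve [F]. *)
- move=> w [Cw hw]; split; first exact: (hT _ jn).1.
  by move=> i ij; rewrite (Tcomm _ _ _ (leq_trans ij jn') jn Cw) hw.
- move=> m w [Cw hw].
  apply: (nested_comp_ind (fun f => f w = w)) => // [f g /= fw ->//|i ij].
  by apply: Sfix; [exact: leq_trans ij jn'|exact: Cw|exact: hw].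
exists w => //; split=> // i; rewrite leq_eqVlt => /predU1P[->//|].
exact: hw.
Qed.

(** * Passage from the generators to the semigroup *)

Lemma rat_independent_cons {R : realType} {n : nat} (alpha : n.-tuple R) :
  rat_independent (cons_tuple 1 alpha) -> int_independent (tnth alpha).
Proof.
move=> halpha k0 k E.
pose nu : 'rV[int]_n.+1 := \row_i (if unlift ord0 i is Some j then k j else k0).
have nu0 : nu = 0.
  apply: contrapT => /eqP nu_neq0; apply: halpha; exists nu; split=> //.
  rewrite big_ord_recl !mxE unlift_none tnth0 mulr1 -[RHS]E; congr (_ + _).
  by apply: eq_bigr => i _; rewrite mxE liftK tnthS.
split=> [|i].
  by have /rowP /(_ ord0) := nu0; rewrite !mxE unlift_none.
by have /rowP /(_ (lift ord0 i)) := nu0; rewrite !mxE liftK.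
Qed.

Lemma free_rV_coord {R : realType} {n : nat} (p : nat -> 'rV[R]_n) :
  free [tuple p i.+1 | i < n] ->
  forall q, exists t : 'I_n -> R, q = \sum_i t i *: p i.+1.
Proof.
move=> hp q; set X := [tuple p i.+1 | i < n].
have XB : basis_of fullv X.
  by rewrite basisEfree hp subvf size_tuple dimvf /= /dim /= mul1n.
exists (fun i => coord X i q).
rewrite {1}(coord_basis XB (memvf q)); apply: eq_bigr => i _.
by rewrite -tnth_nth tnth_mktuple.
Qed.

(* The differences of elements of the semigroup [G] fixing [z] form a group,
   which is dense by Kronecker's theorem. *)
Lemma generators_fixed_point {R : realType} {n : nat}
    {E : completeNormedModType R} {tau : Topological E} {C : set E}
    {T : 'rV[R]_n -> E -> E} {p : nat -> 'rV[R]_n} {alpha : n.-tuple R} {z : E} :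
  hausdorff_space (with_topology tau) -> nonexpansive_semigroup tau C T ->
  (forall j, (j <= n)%N -> nonneg_orthant (p j)) ->
  free [tuple p i.+1 | i < n] -> rat_independent (cons_tuple 1 alpha) ->
  p 0%N = \sum_(i < n) tnth alpha i *: p i.+1 ->
  C z -> (forall j, (j <= n)%N -> T (p j) z = z) ->
  forall q, nonneg_orthant q -> T q z = z.
Proof.
move=> htau hT hp hfree halpha hp0 Cz Tpz q q0.
pose G q := nonneg_orthant q /\ T q z = z.
have Gp j : (j <= n)%N -> G (p j) by move=> jn; split; [exact: hp|exact: Tpz].
have GD a b : G a -> G b -> G (a + b).
  move=> [a0 Ta] [b0 Tb]; split; first by move=> i; rewrite mxE addr_ge0.
  by rewrite (semigroup_add hT)// Tb.
(* The map [T 0] is not prescribed: [T 0 z = T 0 (T (p 0) z) = T (p 0) z = z]. *)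
have G0 : G 0.
  have O0 : @nonneg_orthant R n 0 by move=> i; rewrite mxE.
  split=> //; have [p00 Tp0] := Gp _ (leq0n n).
  by rewrite -{1}Tp0 -(semigroup_add hT)// add0r.
pose D q := exists a b, [/\ G a, G b & q = a - b].
have D0 : D 0 by exists 0, 0; split => //; rewrite subr0.
have DD a b : D a -> D b -> D (a + b).
  move=> [a1 [a2 [Ga1 Ga2 ->]]] [b1 [b2 [Gb1 Gb2 ->]]].
  by exists (a1 + b1), (a2 + b2); split; [exact: GD|exact: GD|rewrite opprD addrACA].
have DN a : D a -> D (- a).
  by move=> [a1 [a2 [Ga1 Ga2 ->]]]; exists a2, a1; rewrite opprB.
have DZ a k : D a -> D (k%:~R *: a).
  have DZn (b : 'rV[R]_n) (m : nat) : D b -> D (m%:R *: b).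
    move=> Db; elim: m => [|m IH]; first by rewrite scale0r.
    by rewrite -natr1 scalerDl scale1r; exact: DD.
  by move=> Da; case: k => m; [exact: DZn|rewrite NegzE rmorphN /= scaleNr; exact/DN/DZn].
have Dp j : (j <= n)%N -> D (p j).
  by move=> /Gp Gpj; exists (p j), 0; rewrite subr0.
(* For [r = a - b]: [T r z = T r (T b z) = T a z = z]. *)
have Dfix r : D r -> nonneg_orthant r -> T r z = z.
  move=> [a [b [[a0 Ta] [b0 Tb] rE]]] r0.
  by rewrite -{1}Tb -(semigroup_add hT)// rE subrK.
(* It will be shown that [z] lies in every neighbourhood of [T q z], so that the two points cannot
   be separated. *)
apply: htau => A B hA hB.
have /subspace_continuousP /(_ q q0) /(_ A hA) := semigroup_continuous hT Cz.
rewrite /= => /nbhs_ballP[e /= e0 he].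
(* Aiming at [q + const_mx d] with error below [d] keeps each coordinate of [r] strictly between
   those of [q] and [q + const_mx e], so [r] stays in the orthant. *)
pose d := e / 2; have d0 : 0 < d by rewrite divr_gt0.
have [t tE] := free_rV_coord p hfree (q + const_mx d).
pose b := 1 + \sum_(i < n) \sum_(j < n) `|p i.+1 ord0 j|.
have b0 : 0 < b by rewrite ltr_wpDr// sumr_ge0// => i _; exact: sumr_ge0.
have db0 : 0 < d / b by rewrite divr_gt0.
have [m [l hml]] := kronecker_approximation _ _ _
  (rat_independent_cons alpha halpha) t (d / b) db0.
pose r := m%:~R *: p 0%N + \sum_(i < n) (l i)%:~R *: p i.+1.
have Dr : D r.
  apply: (DD _ _); first exact/DZ/Dp.
  by apply: (big_ind D D0 DD) => i _; apply: DZ; apply: Dp; exact: ltn_ord.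
have rE : r - (q + const_mx d) =
    \sum_(i < n) (m%:~R * tnth alpha i + (l i)%:~R - t i) *: p i.+1.
  rewrite /r tE hp0 scaler_sumr -big_split -sumrB /=.
  by apply: eq_bigr => i _; rewrite scalerA -scalerDl -scalerBl.
have close j : `|r ord0 j - (q ord0 j + d)| < d.
  have -> : r ord0 j - (q ord0 j + d) = (r - (q + const_mx d)) ord0 j.
    by rewrite !mxE.
  rewrite rE summxE; apply: le_lt_trans (ler_norm_sum _ _ _) _.
  apply: le_lt_trans (_ : d / b * \sum_(i < n) \sum_(k < n) `|p i.+1 ord0 k| < d).
    rewrite mulr_sumr; apply: ler_sum => i _; rewrite mxE normrM.
    apply: ler_pM => //; first exact: ltW.
    by rewrite (bigD1 j)//= lerDl sumr_ge0.
  by rewrite mulrAC ltr_pdivrMr// ltr_pM2l// /b ltrDr.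
have r0 : nonneg_orthant r.
  move=> j; have := close j; have := q0 j; rewrite ltr_distl => ? /andP[? ?]; lra.
exists z; split; last exact: (nbhs_singleton hB).
rewrite -(Dfix r Dr r0); apply: he => //=; split=> // i j.
rewrite (ord1 i) /ball /= distrC.
by have := close j; rewrite !ltr_distl /d => /andP[? ?]; apply/andP; split; lra.
Qed.

Theorem theorem7 (R : realType) (n : nat) (hn : (1 <= n)%N)
    (E : completeNormedModType R) (tau : Topological E)
    (htau : hausdorff_space (with_topology tau))
    (C : set E) (hCcompact : compact C)
    (hCconvex : convex_set C)
    (T : 'rV[R]_n -> E -> E) (hT : nonexpansive_semigroup tau C T)
    (p : nat -> 'rV[R]_n)
    (hp : forall j, (j <= n)%N -> nonneg_orthant (p j))
    (hpfree : free [tuple p i.+1 | i < n])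
    (alpha : n.-tuple R) (halpha : rat_independent (cons_tuple 1 alpha))
    (hp0 : p 0%N = \sum_(i < n) tnth alpha i *: p i.+1)
    (S : nat -> E -> E)
    (hS : forall j x, (j <= n)%N -> C x ->
            S j x = 2^-1 *: T (p j) x + 2^-1 *: x)
    (x : nat -> E) (hx1 : C (x 1%N))
    (hx : forall k, (1 <= k)%N -> x k.+1 = nested_comp S n k (x 1%N)) :
  exists2 z, common_fixed_point C T z & x @ \oo --> z.
Proof.
have T_self j : (j <= n)%N -> nonexpansive_selfmap C (T (p j)).
  move=> jn; have pj0 := hp j jn; split=> [z Cz|y z Cy Cz].
    exact: semigroup_stable hT _ _ pj0 Cz.
  exact: semigroup_nonexpansive hT _ _ _ pj0 Cy Cz.
have T_comm i j z : (i <= n)%N -> (j <= n)%N -> C z ->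
    T (p i) (T (p j) z) = T (p j) (T (p i) z).
  by move=> /hp pi0 /hp pj0 Cz; rewrite -!(semigroup_add hT)// addrC.
have [w [Cw Tw] cw] := nested_comp_cvg C (fun j => T (p j)) S n
  hCcompact hCconvex T_self T_comm hS n (x 1%N) (leqnn n) hx1.
exists w.
  split=> // q.
  exact: (generators_fixed_point htau hT hp hpfree halpha hp0 Cw Tw).
(* [hx] identifies [nested_comp S n k] with [x k.+1] for [k >= 1], hence the shift and the eventual
   equality. *)
rewrite -cvg_shiftS; apply: cvg_trans cw; apply: near_eq_cvg.
near=> k; rewrite /= (hx k)//; near: k; exact: nbhs_infty_ge.
Unshelve. all: by end_near. Qed.
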